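(* Let $\overline{BC}$ be the given strictly monotonically convex negative characteristic of the semi-hyperbolic patch problem described in the context, and draw through its points the positive characteristics moving downward (in the direction $-\bar\partial_+$), in the simple wave region adjacent to the constant state. Then these positive characteristics form an envelope before their sonic points, i.e. on each of them the envelope is reached before the point at which the flow on that characteristic becomes sonic.
   Context: Gas. Fix constants $K,a,b>0$ and $\gamma\in(0,1)$. For density $\rho>0$ put $\tau=1/\rho>b$, $p(\tau)=\frac{K}{(\tau-b)^{\gamma+1}}-\frac{a}{\tau^2}$, and sound speed $c=c(\tau)=\sqrt{-\tau^2p'(\tau)}$. Put $\kappa(\tau)=\frac{-2p'(\tau)}{2p'(\tau)+\tau p''(\tau)}$ and $m(\tau)=\frac{\kappa(\tau)-1}{\kappa(\tau)+1}$. Standing assumption: all values of $\tau$ under consideration lie in a range on which $p'<0$, $p''>0$, $\kappa>0$, $0<m<1$ and $\kappa'>0$. Equations. In self-similar coordinates $(\xi,\eta)=(x/t,y/t)$, with velocity $(u,v)$ and pseudo-velocity $U=u-\xi$, $V=v-\eta$, the system is $$(\rho U)_\xi+(\rho V)_\eta+2\rho=0,\quad UU_\xi+VU_\eta+\tau p_\xi+U=0,\quad UV_\xi+VV_\eta+\tau p_\eta+V=0,$$ with irrotational flow $v_\xi=u_\eta$; there is a potential $\phi$ with $\phi_\xi=U$, $\phi_\eta=V$, normalized so that the pseudo-Bernoulli law $\frac{U^2+V^2}{2}+\frac{K}{(\tau-b)^\gamma}\left(\frac{\gamma+1}{\gamma}+\frac{b}{\tau-b}\right)-\frac{2a}{\tau}+\phi=0$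 holds. Characteristics. Where $U^2+V^2\ge c^2$, set $\lambda_\pm=\frac{UV\pm c\sqrt{U^2+V^2-c^2}}{U^2-c^2}$. The characteristic angles $\alpha,\beta$ are continuous functions with $\tan\alpha=\lambda_+$, $\tan\beta=\lambda_-$, with branches fixed by the boundary inequalities below; $\omega=\frac{\alpha-\beta}{2}$, so $\sin\omega=c/\sqrt{U^2+V^2}$. A point is sonic if $\omega=\pi/2$ there. Put $\bar\partial_+=\cos\alpha\,\partial_\xi+\sin\alpha\,\partial_\eta$, $\bar\partial_-=\cos\beta\,\partial_\xi+\sin\beta\,\partial_\eta$; positive (negative) characteristics are integral curves of $\bar\partial_+$ ($\bar\partial_-$). Along them $\bar\partial_\pm u+\lambda_\mp\bar\partial_\pm v=0$. Boundary data. Let $(\rho_1,0,v_1)$ and $(\rho_4,0,0)$ be constant states with sound speeds $c_1>c_4>0$ and $v_1>0$, connected by the planar rarefaction wave $R_{14}(\eta)$ in $\xi>0$: $\eta=c+v(\rho)$, $v=\int_{\rho_4}^{\rho}\frac{c}{\rho}\,d\rho$ for $\rho_4<\rho<\rho_1$, $u=0$, with $\eta_4\le\eta\le\eta_1$, $\eta_1=v_1+c_1$, $\eta_4=c_4$ (in particular $v_1=\int_{\rho_4}^{\rho_1}\frac{c}{\rho}\,d\rho$). Let $A=(0,v_1+c_1)$, let $\overline{AB}$ be the positive characteristic of $R_{14}$ through $A$, and let $B$ be its intersection with the bottom boundary $\eta=\eta_4$ of the wave; $\overline{AB}$ carries the values of $R_{14}$, and $A$ is sonic. Let $\overline{BD}$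 be the tangential extension of $\overline{AB}$ at $B$ into the constant state $(\rho_4,0,0)$, ending at the sonic point $D$. Let $\overline{BC}$ be a strictly convex negative characteristic starting at $B$, carrying given smooth data compatible at $B$ and satisfying the characteristic relation above, and such that its endpoint $C$ is sonic. Let $\beta_C$ be the inclination angle of $\overline{BC}$ at $C$. The boundary data satisfy: $\beta=0$ and $\pi/2\le\alpha\le\pi$ on $\overline{AB}$; $\pi/2\le\alpha\le\pi+\beta_C$ and $\beta_C\le\beta\le0$ on $\overline{BC}$; $-\pi/2<\beta_C<0$; $\frac{\pi}{4}<\frac{\alpha-\beta}{2}<\frac{\pi}{2}$ on both curves except at the sonic endpoints $A,C$; $\bar\partial_+\alpha>0$ and $\bar\partial_+c>0$ on $\overline{BA}$; $-\bar\partial_-\beta<0$ and $-\bar\partial_-c>0$ on $\overline{BC}$. Simple wave region. On the side of $\overline{BC}$ toward which $-\bar\partial_+$ points, adjacent to the constant state along $\overline{BD}$, the flow is a simple wave: each positive characteristic issuing from a point $P$ of $\overline{BC}$ (with $P\ne C$) is the straight ray from $P$ in the direction $-(\cos\alpha(P),\sin\alpha(P))$, along which $(u,v,c)$ is constant and equal to its value at $P$; in particular $\bar\partial_+c=0$. The sonic point of such a characteristic is the first point on it where $U^2+V^2=c^2$ for these values. The characteristics form an envelope where this one-parameter family of straight lines has an envelope, equivalently where $-\bar\partial_-c$ becomes infinite along the characteristic. *)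

(* Defs.v *)
From Stdlib Require Import Reals.
From Coquelicot Require Import Coquelicot.
Open Scope R_scope.

Record gas := Gas { gK : R; ga : R; gb : R; ggamma : R }.

Definition gas_ok (g : gas) : Prop :=
  0 < gK g /\ 0 < ga g /\ 0 < gb g /\ 0 < ggamma g < 1.

Definition pressure (g : gas) (tau : R) : R :=
  gK g / Rpower (tau - gb g) (ggamma g + 1) - ga g / tau ^ 2.

Definition sound (g : gas) (tau : R) : R :=
  sqrt (- (tau ^ 2 * Derive (pressure g) tau)).

Definition kappa (g : gas) (tau : R) : R :=
  - 2 * Derive (pressure g) tau
  / (2 * Derive (pressure g) tau + tau * Derive_n (pressure g) 2 tau).

Definition mcoef (g : gas) (tau : R) : R :=
  (kappa g tau - 1) / (kappa g tau + 1).

(** Antiderivative of [tau * p'(tau)], as it occurs in the pseudo-Bernoulli law. *)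
Definition enthalpy (g : gas) (tau : R) : R :=
  gK g / Rpower (tau - gb g) (ggamma g)
    * ((ggamma g + 1) / ggamma g + gb g / (tau - gb g))
  - 2 * ga g / tau.

Definition admissible (g : gas) (tau : R) : Prop :=
  gb g < tau
  /\ Derive (pressure g) tau < 0
  /\ 0 < Derive_n (pressure g) 2 tau
  /\ 0 < kappa g tau
  /\ 0 < mcoef g tau < 1
  /\ 0 < Derive (kappa g) tau.

(** A curve parametrised by arc length [s] in [[0, len]], with the values of
    [u], [v], [tau], the pseudo-potential and the characteristic angles along
    it. The fields are total functions; only their values on [[0, len]] are
    constrained, those for [s < 0] merely extend the data so that [Derive] at
    [s = 0] is the one-sided derivative. *)
Record flow_curve := FlowCurve {
  len : R;
  cxi : R -> R;
  ceta : R -> R;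
  cu : R -> R;
  cv : R -> R;
  ctau : R -> R;
  cphi : R -> R;
  calpha : R -> R;
  cbeta : R -> R }.

Definition cU (G : flow_curve) (s : R) : R := cu G s - cxi G s.
Definition cV (G : flow_curve) (s : R) : R := cv G s - ceta G s.
Definition csound (g : gas) (G : flow_curve) (s : R) : R := sound g (ctau G s).
Definition comega (G : flow_curve) (s : R) : R := (calpha G s - cbeta G s) / 2.

(** [tan theta = num / den], with value infinity when [den = 0]. *)
Definition has_slope (theta num den : R) : Prop :=
  sin theta * den = cos theta * num.

(** [alpha] and [beta] are the angles of the [lambda_+] and [lambda_-]
    directions. The last equation is needed only where [U^2 = c^2]: there one
    of the two slopes reads [0 / 0]. *)
Definition char_angles (U V c alpha beta : R) : Prop :=
  c ^ 2 <= U ^ 2 + V ^ 2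
  /\ has_slope alpha (U * V + c * sqrt (U ^ 2 + V ^ 2 - c ^ 2)) (U ^ 2 - c ^ 2)
  /\ has_slope beta (U * V - c * sqrt (U ^ 2 + V ^ 2 - c ^ 2)) (U ^ 2 - c ^ 2)
  /\ sin ((alpha - beta) / 2) = c / sqrt (U ^ 2 + V ^ 2).

Definition C1_at (f : R -> R) (s : R) : Prop :=
  ex_derive f s /\ continuous (Derive f) s.

(** Continuous up to the final point and smooth before it. The final points of
    the curves below are sonic, where the angles need not be differentiable. *)
Definition smooth_data (l : R) (f : R -> R) : Prop :=
  continuous_on (fun s => 0 <= s <= l) f
  /\ forall s, 0 <= s < l -> C1_at f s.

(** The curve has unit tangent [(cos (theta s), sin (theta s))] and carries
    smooth values satisfying the pseudo-Bernoulli law, where the potential has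
    gradient [(U, V)]. *)
Record carries_flow (g : gas) (G : flow_curve) (theta : R -> R) : Prop := {
  cf_len : 0 < len G;
  cf_xi : smooth_data (len G) (cxi G);
  cf_eta : smooth_data (len G) (ceta G);
  cf_u : smooth_data (len G) (cu G);
  cf_v : smooth_data (len G) (cv G);
  cf_tau : smooth_data (len G) (ctau G);
  cf_phi : smooth_data (len G) (cphi G);
  cf_alpha : smooth_data (len G) (calpha G);
  cf_beta : smooth_data (len G) (cbeta G);
  cf_adm : forall s, 0 <= s <= len G -> admissible g (ctau G s);
  cf_angles : forall s, 0 <= s <= len G ->
    char_angles (cU G s) (cV G s) (csound g G s) (calpha G s) (cbeta G s);
  cf_bernoulli : forall s, 0 <= s <= len G ->
    (cU G s ^ 2 + cV G s ^ 2) / 2 + enthalpy g (ctau G s) + cphi G s = 0;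
  cf_tangent_xi : forall s, 0 <= s < len G -> is_derive (cxi G) s (cos (theta s));
  cf_tangent_eta : forall s, 0 <= s < len G -> is_derive (ceta G) s (sin (theta s));
  cf_potential : forall s, 0 <= s < len G ->
    is_derive (cphi G) s (cU G s * cos (theta s) + cV G s * sin (theta s)) }.

(** The point at distance [r] from the point [P] of parameter [s], in the
    direction [- (cos alpha(P), sin alpha(P))]. *)
Definition ray_xi (G : flow_curve) (s r : R) : R := cxi G s - r * cos (calpha G s).
Definition ray_eta (G : flow_curve) (s r : R) : R := ceta G s - r * sin (calpha G s).

(** Along the ray, [(u, v, c)] keeps its value at [P]. *)
Definition ray_q2 (G : flow_curve) (s r : R) : R :=
  (cu G s - ray_xi G s r) ^ 2 + (cv G s - ray_eta G s r) ^ 2.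

Definition ray_sonic (g : gas) (G : flow_curve) (s r : R) : Prop :=
  ray_q2 G s r = csound g G s ^ 2.

(** [line_eq G s x y = 0] is the equation of the straight line carrying the
    ray of parameter [s]. *)
Definition line_eq (G : flow_curve) (s x y : R) : R :=
  (y - ceta G s) * cos (calpha G s) - (x - cxi G s) * sin (calpha G s).

(** The envelope of a one-parameter family of lines [F(s; x, y) = 0]: at a
    point of the line of parameter [s], [F = 0] and [dF/ds = 0]. *)
Definition ray_envelope (G : flow_curve) (s r : R) : Prop :=
  line_eq G s (ray_xi G s r) (ray_eta G s r) = 0
  /\ is_derive (fun t => line_eq G t (ray_xi G s r) (ray_eta G s r)) s 0.

(** The first distance along a ray at which [Q] holds. *)
Definition first_distance (Q : R -> Prop) (r : R) : Prop :=
  0 <= r /\ Q r /\ forall r', 0 <= r' < r -> ~ Q r'.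

(** Angle of the negative characteristic at a point of the ray:
    [alpha - beta = 2 omega] with [sin omega = c / sqrt (U^2 + V^2)]. *)
Definition ray_beta (g : gas) (G : flow_curve) (s r : R) : R :=
  calpha G s - 2 * asin (csound g G s / sqrt (ray_q2 G s r)).

(** The derivative of [c] along the negative characteristic in the simple wave.
    In the coordinates [(s, r)] the field [c] depends on [s] only, so this is
    [(dc/ds) * ds], where [X_s ds + X_r dr = (cos beta, sin beta)] for
    [X = (ray_xi, ray_eta)]; [ds] is given by Cramer's rule. *)
Definition ray_dminus_c (g : gas) (G : flow_curve) (s r : R) : R :=
  let xs := Derive (fun t => ray_xi G t r) s in
  let ys := Derive (fun t => ray_eta G t r) s in
  let xr := Derive (fun t => ray_xi G s t) r in
  let yr := Derive (fun t => ray_eta G s t) r in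
  let b := ray_beta g G s r in
  Derive (csound g G) s
  * ((cos b * yr - sin b * xr) / (xs * yr - ys * xr)).

(** [v] in the planar rarefaction wave, as a function of the density. *)
Definition wave_v (g : gas) (rho4 rho : R) : R :=
  RInt (fun r => sound g (/ r) / r) rho4 rho.

(** [AB] is parametrised from [B] to [A], hence in the direction of
    [(cos alpha, sin alpha)]; [BC] from [B] to [C], hence against
    [(cos beta, sin beta)], so that the derivative along the negative
    characteristic is minus the derivative in [s]. *)
Record patch_data (g : gas) (rho1 rho4 v1 : R) (AB BC : flow_curve)
    (betaC xiD etaD : R) : Prop := {
  pd_rho : 0 < rho4 < rho1;
  pd_v1 : 0 < v1;
  pd_c : 0 < sound g (/ rho4) < sound g (/ rho1);
  pd_adm : forall tau, / rho1 <= tau <= / rho4 -> admissible g tau;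
  pd_v1_wave : v1 = wave_v g rho4 rho1;

  pd_AB : carries_flow g AB (calpha AB);
  pd_AB_wave : forall s, 0 <= s <= len AB ->
    / rho1 <= ctau AB s <= / rho4
    /\ cu AB s = 0
    /\ cv AB s = wave_v g rho4 (/ ctau AB s)
    /\ ceta AB s = csound g AB s + cv AB s;
  pd_AB_right : forall s, 0 <= s < len AB -> 0 < cxi AB s;
  pd_A : cxi AB (len AB) = 0 /\ ceta AB (len AB) = v1 + sound g (/ rho1);
  pd_A_sonic : comega AB (len AB) = PI / 2;
  pd_B : ceta AB 0 = sound g (/ rho4);
  pd_AB_angles : forall s, 0 <= s <= len AB ->
    cbeta AB s = 0 /\ PI / 2 <= calpha AB s <= PI;
  pd_AB_omega : forall s, 0 <= s < len AB -> PI / 4 < comega AB s < PI / 2;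
  pd_AB_dalpha : forall s, 0 <= s < len AB -> 0 < Derive (calpha AB) s;
  pd_AB_dc : forall s, 0 <= s < len AB -> 0 < Derive (csound g AB) s;

  pd_BD : exists d, 0 < d
    /\ xiD = ray_xi AB 0 d /\ etaD = ray_eta AB 0 d
    /\ first_distance
         (fun r => ray_xi AB 0 r ^ 2 + ray_eta AB 0 r ^ 2 = sound g (/ rho4) ^ 2) d;

  pd_BC : carries_flow g BC (fun s => cbeta BC s + PI);
  pd_BC_start : cxi BC 0 = cxi AB 0 /\ ceta BC 0 = ceta AB 0;
  pd_BC_compat : cu BC 0 = 0 /\ cv BC 0 = 0 /\ ctau BC 0 = / rho4
    /\ cphi BC 0 = cphi AB 0
    /\ calpha BC 0 = calpha AB 0 /\ cbeta BC 0 = cbeta AB 0;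
  (* the relation du + lambda_+ dv = 0, multiplied by cos alpha *)
  pd_BC_relation : forall s, 0 <= s < len BC ->
    cos (calpha BC s) * Derive (cu BC) s + sin (calpha BC s) * Derive (cv BC) s = 0;
  pd_BC_convex : forall s t, 0 <= s -> s < t -> t <= len BC -> cbeta BC t < cbeta BC s;
  pd_C_sonic : comega BC (len BC) = PI / 2;
  pd_betaC : cbeta BC (len BC) = betaC /\ - PI / 2 < betaC < 0;
  pd_BC_angles : forall s, 0 <= s <= len BC ->
    PI / 2 <= calpha BC s <= PI + betaC /\ betaC <= cbeta BC s <= 0;
  pd_BC_omega : forall s, 0 <= s < len BC -> PI / 4 < comega BC s < PI / 2;
  pd_BC_dbeta : forall s, 0 <= s < len BC -> Derive (cbeta BC) s < 0;
  pd_BC_dc : forall s, 0 <= s < len BC -> 0 < Derive (csound g BC) s }.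

(* Main.v *)
Require Import Defs.
From Stdlib Require Import Reals Lra.
From Coquelicot Require Import Coquelicot.
Open Scope R_scope.

(** Write [sigma = (alpha + beta) / 2], and primes for derivatives along [BC]
    (except in [p'], the derivative of the pressure in [tau]).

    Where the flow is not sonic, the characteristic directions determine the
    line of the pseudo-velocity: [(U, V) = L (cos sigma, sin sigma)] with
    [L sin omega = c] or [L sin omega = - c]. At [B] the gas is at rest in the
    first quadrant, so [L < 0] there; [L] never vanishes, hence it stays negative
    up to [C] ([backward_flow_of_start]). In the frame of the positive
    characteristic this says
      [U sin alpha - V cos alpha = - c],
      [U cos alpha + V sin alpha = - c cot omega].

    Moving a distance [r] down the ray leaves the first component unchanged and
    adds [r] to the second, so [U^2 + V^2 = c^2 + (r - c cot omega)^2]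
    ([ray_q2_sonic_distance]): the sonic point is at distance [c cot omega].
    Differentiating the equation of the lines in the parameter shows that the
    envelope is at distance [sin (2 omega) / alpha'] ([ray_envelope_iff]).

    The comparison of the two distances comes from differentiating
    [U sin alpha - V cos alpha = - c] along [BC] ([alpha_derivative]):
      [alpha' c cot omega = c' + k + sin (2 omega)],
      [k = u' sin alpha - v' cos alpha].
    Here [c' > 0] by hypothesis. The relation along the negative characteristic
    makes [(u', v')] equal to [k (sin alpha, - cos alpha)], and Bernoulli's law
    then gives [k c = tau p' tau'], which is positive because [p' < 0] and
    [tau] decreases where [c] increases ([velocity_derivative_pos]). So
    [alpha' > 0] and [sin (2 omega) / alpha' < c cot omega].

    Finally, minus the derivative of [c] along the negative characteristic is, at
    distance [r] and with [omega_r] the value of [omega] there,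
    [c' sin (2 omega_r) / (sin (2 omega) - r alpha')]. The denominator decreases
    to [0] at the envelope, whereas [omega_r] is still less than [PI / 2] because
    the sonic point lies farther, so the numerator keeps a positive limit. *)

(** * Real analysis *)

(* [auto_derive] leaves derivatives of eta-expanded functions. *)
Ltac eta_derive :=
  repeat match goal with
  | |- context [Derive (fun x : R => ?f x)] => progress change (fun x : R => f x) with f
  end.

(** The identities along a curve hold from its starting point on, whereas
    [is_derive] is two-sided; vanishing on the right is enough to differentiate
    them at the starting point as well. *)
Lemma derive_zero_of_right (f : R -> R) (s l e : R) :
  s < e -> (forall t, s <= t < e -> f t = 0) -> is_derive f s l -> l = 0.
Proof.
  intros He Hf Hd.
  apply is_derive_Reals in Hd.
  destruct (Req_dec l 0) as [H|H]; [exact H|exfalso].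
  destruct (Hd (Rabs l) (Rabs_pos_lt _ H)) as [d Hdd].
  pose proof (cond_pos d) as Hp.
  (* a step that stays in the differentiability window and inside [[s, e)] *)
  set (h := Rmin (d / 2) ((e - s) / 2)).
  assert (Hh : 0 < h) by (apply Rmin_glb_lt; lra).
  assert (Hh1 : h <= d / 2) by apply Rmin_l.
  assert (Hh2 : h <= (e - s) / 2) by apply Rmin_r.
  specialize (Hdd h ltac:(lra)).
  rewrite (Rabs_pos_eq h) in Hdd by lra.
  specialize (Hdd ltac:(lra)).
  rewrite (Hf (s + h)), (Hf s) in Hdd by lra.
  replace ((0 - 0) / h - l) with (- l) in Hdd by (field; lra).
  rewrite Rabs_Ropp in Hdd. lra.
Qed.

Lemma filterlim_div_at_left (f : R -> R) (x0 d : R) :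
  0 < d -> continuous f x0 -> 0 < f x0 ->
  filterlim (fun r => f r / (d * (x0 - r))) (at_left x0) (Rbar_locally p_infty).
Proof.
  intros Hd Hc Hf P [M HM].
  pose proof (Rabs_pos M) as HMp. pose proof (Rle_abs M) as HMa.
  (* on the left of [x0], within [h], the quotient exceeds [Rabs M + 1] as soon
     as [f > f x0 / 2] *)
  set (h := f x0 / (2 * d * (Rabs M + 1))).
  assert (Hh : 0 < h) by (apply Rdiv_lt_0_compat; nra).
  assert (Hfd : locally x0 (fun r => f x0 / 2 < f r)).
  { apply (Hc (fun y => f x0 / 2 < y)). apply open_gt. lra. }
  assert (Hl : locally x0 (fun r => x0 - h < r)) by (apply open_gt; lra).
  unfold filtermap, at_left, within.
  generalize (filter_and _ _ Hfd Hl). apply filter_imp.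
  intros r [H1 H2] Hr. apply HM.
  apply Rle_lt_trans with (Rabs M + 1 - 1); [lra|].
  apply Rlt_le_trans with (Rabs M + 1); [lra|].
  apply Rmult_le_reg_r with (d * (x0 - r)); [nra|].
  replace (f r / (d * (x0 - r)) * (d * (x0 - r))) with (f r) by (field; lra).
  assert (Hk : h * (2 * d * (Rabs M + 1)) = f x0) by (unfold h; field; lra).
  assert (0 < d * (Rabs M + 1)) by nra.
  nra.
Qed.

(** * Thermodynamics of the gas *)

Lemma is_derive_pressure (g : gas) (tau : R) :
  0 < gb g < tau ->
  is_derive (pressure g) tau
    (2 * ga g / tau ^ 3
     - gK g * (ggamma g + 1) / ((tau - gb g) * Rpower (tau - gb g) (ggamma g + 1))).
Proof.
  intros H. unfold pressure, Rpower.
  pose proof (exp_pos ((ggamma g + 1) * ln (tau - gb g))) as He.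
  auto_derive.
  - repeat split; try lra; apply Rgt_not_eq;
      repeat apply Rmult_gt_0_compat; first [apply exp_pos | lra].
  - change (tau + - gb g) with (tau - gb g).
    set (E := exp _) in *. field. repeat split; lra.
Qed.

Lemma ex_derive_Derive_pressure (g : gas) (tau : R) :
  0 < gb g < tau -> ex_derive (Derive (pressure g)) tau.
Proof.
  intros H.
  eapply ex_derive_ext_loc with
    (f := fun t => 2 * ga g / t ^ 3
       - gK g * (ggamma g + 1) / ((t - gb g) * Rpower (t - gb g) (ggamma g + 1))).
  - assert (Hl : locally tau (fun t => gb g < t)) by (apply open_gt; lra).
    revert Hl. apply filter_imp. intros t Ht. symmetry.
    apply is_derive_unique, is_derive_pressure. lra.
  - unfold Rpower.
    auto_derive. repeat split; try lra; apply Rgt_not_eq;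
      repeat apply Rmult_gt_0_compat; first [apply exp_pos | lra].
Qed.

Lemma is_derive_enthalpy (g : gas) (tau : R) :
  0 < gb g < tau -> 0 < ggamma g ->
  is_derive (enthalpy g) tau (tau * Derive (pressure g) tau).
Proof.
  intros H Hg.
  rewrite (is_derive_unique _ _ _ (is_derive_pressure g tau H)).
  rewrite Rpower_plus, Rpower_1 by lra.
  unfold enthalpy, Rpower.
  pose proof (exp_pos (ggamma g * ln (tau - gb g))) as He.
  auto_derive.
  - repeat split; try lra; apply Rgt_not_eq;
      repeat apply Rmult_gt_0_compat; first [apply exp_pos | lra].
  - change (tau + - gb g) with (tau - gb g).
    set (E := exp _) in *. field. repeat split; lra.
Qed.

Lemma sound_pos (g : gas) (tau : R) :
  0 < gb g -> admissible g tau -> 0 < sound g tau.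
Proof.
  intros Hb (H1 & H2 & _). unfold sound. apply sqrt_lt_R0.
  assert (0 < tau ^ 2) by (apply pow_lt; lra). nra.
Qed.

Lemma is_derive_sound (g : gas) (tau : R) :
  0 < gb g -> admissible g tau ->
  is_derive (sound g) tau
    (- tau * (2 * Derive (pressure g) tau + tau * Derive_n (pressure g) 2 tau)
     / (2 * sound g tau)).
Proof.
  intros Hb Ha. pose proof (sound_pos g tau Hb Ha) as Hs.
  destruct Ha as (H1 & H2 & _).
  pose proof (ex_derive_Derive_pressure g tau (conj Hb H1)) as He.
  change (Derive_n (pressure g) 2 tau) with (Derive (Derive (pressure g)) tau).
  set (p' := Derive (pressure g)) in *.
  change (sound g) with (fun t => sqrt (- (t ^ 2 * p' t))) in *.
  assert (He' : is_derive p' tau (Derive p' tau)) by (apply Derive_correct, He).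
  set (p'' := Derive p' tau) in *. clearbody p''.
  simpl in Hs.
  evar_last.
  - apply (is_derive_comp sqrt (fun t => - (t ^ 2 * p' t))).
    + auto_derive; [|reflexivity].
      assert (0 < tau ^ 2) by (apply pow_lt; lra). nra.
    + apply (is_derive_opp (fun t => t ^ 2 * p' t)).
      apply (is_derive_mult (fun t => t ^ 2) p').
      * auto_derive; [exact I|reflexivity].
      * exact He'.
      * intros; apply Rmult_comm.
  - unfold scal, opp, plus, mult; simpl. unfold mult; simpl.
    field. lra.
Qed.

(** The numerator [- 2 p'] of [kappa] is positive, so [kappa > 0] fixes the sign
    of its denominator. That sign makes the sound speed a decreasing function of
    [tau]. *)
Lemma kappa_denominator_pos (g : gas) (tau : R) :
  admissible g tau ->
  0 < 2 * Derive (pressure g) tau + tau * Derive_n (pressure g) 2 tau.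
Proof.
  intros (_ & H2 & _ & Hk & _). unfold kappa in Hk.
  set (d := 2 * Derive (pressure g) tau + tau * Derive_n (pressure g) 2 tau) in *.
  destruct (Rlt_le_dec 0 d) as [H|H]; [exact H|exfalso].
  destruct (Req_dec d 0) as [H0|H0].
  - rewrite H0 in Hk. unfold Rdiv in Hk. rewrite Rinv_0 in Hk. lra.
  - assert (/ d < 0) by (apply Rinv_lt_0_compat; lra). unfold Rdiv in Hk. nra.
Qed.

(** * Direction of the pseudo-velocity *)

(** Mach's law: the flow direction bisects the characteristic directions. With
    [q^2 = U^2 + V^2], [S^2 = q^2 - c^2], the vector giving the slope of
    [lambda_+] factors as
      [(U^2 - c^2, U V + c S) = (U S + V c) / q^2 * (U S - V c, V S + U c)],
    and that of [lambda_-] likewise with [- c]. So each slope condition is the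
    equation [U sin sigma = V cos sigma] times a factor, which can vanish only
    where the slope reads [0 / 0]. Both factors vanish only at a stagnation
    point, so one of the two conditions always gives the equation. *)
Lemma char_angles_direction (U V c alpha beta : R) :
  0 < c -> 0 < (alpha - beta) / 2 < PI / 2 -> char_angles U V c alpha beta ->
  U * sin ((alpha + beta) / 2) = V * cos ((alpha + beta) / 2)
  /\ (U ^ 2 + V ^ 2) * sin ((alpha - beta) / 2) ^ 2 = c ^ 2.
Proof.
  intros Hc Hw (Hq & Ha & Hb & Hs). unfold has_slope in *.
  set (w := (alpha - beta) / 2) in *. set (sg := (alpha + beta) / 2).
  replace alpha with (sg + w) in * by (unfold sg, w; lra).
  replace beta with (sg - w) in * by (unfold sg, w; lra).
  assert (Hsw : 0 < sin w) by (apply sin_gt_0; lra).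
  assert (Hcw : 0 < cos w) by (apply cos_gt_0; lra).
  pose proof (sin2_cos2 w) as Hw1. unfold Rsqr in Hw1.
  assert (Hq0 : 0 < U ^ 2 + V ^ 2) by nra.
  set (q := sqrt (U ^ 2 + V ^ 2)) in *.
  assert (Hqp : 0 < q) by (apply sqrt_lt_R0, Hq0).
  assert (Hqq : q ^ 2 = U ^ 2 + V ^ 2) by (apply pow2_sqrt; lra).
  assert (Hcq : c = q * sin w) by (rewrite Hs; field; lra).
  assert (HS : sqrt (U ^ 2 + V ^ 2 - c ^ 2) = q * cos w).
  { apply sqrt_lem_1; nra. }
  rewrite HS in *. rewrite <- Hqq.
  split; [|rewrite Hcq; ring].
  rewrite sin_plus, cos_plus in Ha. rewrite sin_minus, cos_minus in Hb.
  clearbody q w sg. subst c.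
  set (D := U * sin sg - V * cos sg).
  assert (Hq2 : q * q = U * U + V * V) by lra.
  (* the [lambda_+] and [lambda_-] conditions, after the factorization *)
  assert (HA : (U * cos w + V * sin w) * D = 0).
  { transitivity
      ((sin sg * cos w + cos sg * sin w) * (U ^ 2 - (q * sin w) ^ 2)
       - (cos sg * cos w - sin sg * sin w) * (U * V + q * sin w * (q * cos w))
       + (q * q) * sin w * cos sg * (sin w * sin w + cos w * cos w - 1)
       - (U * U + V * V - q * q) * sin w * cos sg); [unfold D; ring|].
    rewrite Ha, Hw1, Hq2. ring. }
  assert (HB : (U * cos w - V * sin w) * D = 0).
  { transitivity
      ((sin sg * cos w - cos sg * sin w) * (U ^ 2 - (q * sin w) ^ 2)
       - (cos sg * cos w + sin sg * sin w) * (U * V - q * sin w * (q * cos w))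
       - (q * q) * sin w * cos sg * (sin w * sin w + cos w * cos w - 1)
       + (U * U + V * V - q * q) * sin w * cos sg); [unfold D; ring|].
    rewrite Hb, Hw1, Hq2. ring. }
  destruct (Req_dec D 0) as [H|H]; [unfold D in H; lra|exfalso].
  apply Rmult_integral in HA as [HA|HA]; [|contradiction].
  apply Rmult_integral in HB as [HB|HB]; [|contradiction].
  assert (U = 0) by nra. assert (V = 0) by nra. subst. nra.
Qed.

Definition flow_along (G : flow_curve) (s : R) : R :=
  cU G s * cos ((calpha G s + cbeta G s) / 2)
  + cV G s * sin ((calpha G s + cbeta G s) / 2).

(** The angles are fixed modulo [PI] by the slopes only, so the pseudo-velocity
    has direction [sigma] or [sigma + PI]; in the patch it is the latter. Since
    [sin omega = c / sqrt (U^2 + V^2)], the pseudo-speed is [c / sin omega]. *)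
Definition backward_flow (g : gas) (G : flow_curve) : Prop :=
  forall s, 0 <= s < len G ->
    0 < sin (comega G s)
    /\ cU G s = - (csound g G s / sin (comega G s))
                * cos ((calpha G s + cbeta G s) / 2)
    /\ cV G s = - (csound g G s / sin (comega G s))
                * sin ((calpha G s + cbeta G s) / 2).

(** The pseudo-speed along the positive characteristic at the foot of the ray. On
    the ray it decreases by the distance covered, and the flow is sonic where
    only the component [c] normal to the ray is left. *)
Definition sonic_distance (g : gas) (G : flow_curve) (s : R) : R :=
  csound g G s * cos (comega G s) / sin (comega G s).

Lemma csound_pos (g : gas) (G : flow_curve) (theta : R -> R) (s : R) :
  0 < gb g -> carries_flow g G theta -> 0 <= s <= len G -> 0 < csound g G s.
Proof.
  intros Hb HG Hs. apply sound_pos; [exact Hb|]. apply (cf_adm _ _ _ HG), Hs.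
Qed.

Lemma ex_derive_smooth_data (l : R) (f : R -> R) (s : R) :
  smooth_data l f -> 0 <= s < l -> ex_derive f s.
Proof. intros [_ H] Hs. apply H, Hs. Qed.

Lemma ex_derive_csound (g : gas) (G : flow_curve) (theta : R -> R) (s : R) :
  0 < gb g -> carries_flow g G theta -> 0 <= s < len G ->
  ex_derive (csound g G) s.
Proof.
  intros Hb HG Hs. unfold csound.
  apply (ex_derive_comp (sound g) (ctau G)).
  - eexists. apply is_derive_sound; [exact Hb|]. apply (cf_adm _ _ _ HG); lra.
  - apply (ex_derive_smooth_data _ _ _ (cf_tau _ _ _ HG) Hs).
Qed.

(** The sign of [flow_along] propagates from the start of the curve: its modulus
    is [c / sin omega], so it cannot change sign without violating [c > 0]. *)
Lemma backward_flow_of_start (g : gas) (G : flow_curve) (theta : R -> R) :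
  0 < gb g -> carries_flow g G theta ->
  (forall s, 0 <= s < len G -> 0 < comega G s < PI / 2) ->
  flow_along G 0 < 0 -> backward_flow g G.
Proof.
  intros Hb HG Hw H0.
  assert (Hdir : forall s, 0 <= s < len G ->
    cU G s = flow_along G s * cos ((calpha G s + cbeta G s) / 2)
    /\ cV G s = flow_along G s * sin ((calpha G s + cbeta G s) / 2)
    /\ (flow_along G s * sin (comega G s)) ^ 2 = csound g G s ^ 2
    /\ 0 < sin (comega G s)).
  { intros s Hs. pose proof (Hw s Hs) as Hws.
    destruct (char_angles_direction _ _ _ _ _
      (csound_pos g G theta s Hb HG ltac:(lra)) Hws
      (cf_angles _ _ _ HG s ltac:(lra))) as [H1 H2].
    fold (comega G s) in H2. unfold flow_along.
    set (sg := (calpha G s + cbeta G s) / 2) in *.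
    pose proof (sin2_cos2 sg) as Hsg. unfold Rsqr in Hsg.
    assert (HU : cU G s = (cU G s * cos sg + cV G s * sin sg) * cos sg).
    { transitivity (cU G s * cos sg * cos sg + cV G s * cos sg * sin sg); [|ring].
      rewrite <- H1. transitivity (cU G s * (sin sg * sin sg + cos sg * cos sg));
        [rewrite Hsg|]; ring. }
    assert (HV : cV G s = (cU G s * cos sg + cV G s * sin sg) * sin sg).
    { transitivity (cU G s * sin sg * cos sg + cV G s * sin sg * sin sg); [|ring].
      rewrite H1. transitivity (cV G s * (sin sg * sin sg + cos sg * cos sg));
        [rewrite Hsg|]; ring. }
    repeat split; [exact HU|exact HV| |apply sin_gt_0; lra].
    set (L := cU G s * cos sg + cV G s * sin sg) in *.
    rewrite <- H2, HU, HV.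
    transitivity (L * L * (sin sg * sin sg + cos sg * cos sg) * sin (comega G s) ^ 2);
      [rewrite Hsg|]; ring. }
  assert (Hneg : forall s, 0 <= s < len G -> flow_along G s < 0).
  { intros s Hs.
    destruct (Rlt_le_dec (flow_along G s) 0) as [H|H]; [exact H|exfalso].
    assert (Hnz : forall t, 0 <= t < len G -> flow_along G t <> 0).
    { intros t Ht E. destruct (Hdir t Ht) as (_ & _ & H2 & _). rewrite E in H2.
      pose proof (csound_pos g G theta t Hb HG ltac:(lra)). nra. }
    pose proof (Hnz s Hs) as Hnzs.
    assert (Hs0 : 0 < s) by (destruct (Req_dec s 0); [subst; lra|lra]).
    destruct (Ranalysis5.IVT_interv (flow_along G) 0 s) as [z [Hz1 Hz2]]; try lra.
    - intros t Ht. apply derivable_continuous_pt, ex_derive_Reals_0.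
      assert (Htl : 0 <= t < len G) by lra.
      pose proof (ex_derive_smooth_data _ _ _ (cf_u _ _ _ HG) Htl).
      pose proof (ex_derive_smooth_data _ _ _ (cf_v _ _ _ HG) Htl).
      pose proof (ex_derive_smooth_data _ _ _ (cf_xi _ _ _ HG) Htl).
      pose proof (ex_derive_smooth_data _ _ _ (cf_eta _ _ _ HG) Htl).
      pose proof (ex_derive_smooth_data _ _ _ (cf_alpha _ _ _ HG) Htl).
      pose proof (ex_derive_smooth_data _ _ _ (cf_beta _ _ _ HG) Htl).
      unfold flow_along, cU, cV. auto_derive. tauto.
    - apply (Hnz z); lra. }
  intros s Hs. destruct (Hdir s Hs) as (HU & HV & HL & Hsw).
  pose proof (Hneg s Hs) as HLn.
  pose proof (csound_pos g G theta s Hb HG ltac:(lra)) as Hc.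
  assert (E : flow_along G s = - (csound g G s / sin (comega G s))).
  { assert (flow_along G s * sin (comega G s) = - csound g G s).
    { assert (HLs : flow_along G s * sin (comega G s) < 0) by nra.
      set (y := flow_along G s * sin (comega G s)) in *.
      assert (E : (y + csound g G s) * (y - csound g G s) = 0) by nra.
      apply Rmult_integral in E as [E|E]; lra. }
    apply Rmult_eq_reg_r with (sin (comega G s)); [|lra].
    rewrite H. field. lra. }
  rewrite <- E. auto.
Qed.

(** The frame of the positive characteristic, at angle [omega] from [sigma]. *)
Lemma backward_flow_components (g : gas) (G : flow_curve) (s : R) :
  backward_flow g G -> 0 <= s < len G ->
  cU G s * sin (calpha G s) - cV G s * cos (calpha G s) = - csound g G s
  /\ cU G s * cos (calpha G s) + cV G s * sin (calpha G s)
     = - sonic_distance g G s.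
Proof.
  intros H Hs. destruct (H s Hs) as (Hw & HU & HV). rewrite HU, HV.
  unfold sonic_distance.
  set (c := csound g G s).
  set (sg := (calpha G s + cbeta G s) / 2). set (w := comega G s) in *.
  replace (calpha G s) with (sg + w) by (unfold sg, w, comega; lra).
  rewrite sin_plus, cos_plus.
  pose proof (sin2_cos2 sg) as Hsg. unfold Rsqr in Hsg. split.
  - transitivity (- (c / sin w) * sin w * (sin sg * sin sg + cos sg * cos sg));
      [ring|rewrite Hsg; field; lra].
  - transitivity (- (c / sin w) * cos w * (sin sg * sin sg + cos sg * cos sg));
      [ring|rewrite Hsg; field; lra].
Qed.

(** * Pseudo-velocity along a ray *)

(** Moving against [(cos alpha, sin alpha)] by [r] adds [r] to the tangential
    component, which is [- sonic_distance] at [P], and keeps the normal component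
    [- c]. *)
Lemma ray_q2_sonic_distance (g : gas) (G : flow_curve) (s r : R) :
  backward_flow g G -> 0 <= s < len G ->
  ray_q2 G s r = csound g G s ^ 2 + (r - sonic_distance g G s) ^ 2.
Proof.
  intros H Hs. destruct (backward_flow_components g G s H Hs) as [HN HM].
  pose proof (sin2_cos2 (calpha G s)) as Ha. unfold Rsqr in Ha.
  replace (csound g G s) with (- (- csound g G s)) by ring.
  replace (r - sonic_distance g G s) with (r + - sonic_distance g G s) by ring.
  rewrite <- HN, <- HM.
  unfold ray_q2, ray_xi, ray_eta, cU, cV.
  set (x := cu G s - cxi G s). set (y := cv G s - ceta G s).
  set (ca := cos (calpha G s)) in *. set (sa := sin (calpha G s)) in *.
  replace (cu G s - (cxi G s - r * ca)) with (x + r * ca) by (unfold x; ring).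
  replace (cv G s - (ceta G s - r * sa)) with (y + r * sa) by (unfold y; ring).
  transitivity (x ^ 2 + y ^ 2 + 2 * r * (x * ca + y * sa)
    + r ^ 2 * (sa * sa + ca * ca)); [ring|].
  transitivity ((x ^ 2 + y ^ 2) * (sa * sa + ca * ca)
    + 2 * r * (x * ca + y * sa) + r ^ 2); [rewrite Ha|]; ring.
Qed.

(** * Growth of the angle along the negative characteristic *)

(** The position terms of [U U' + V V'] cancel the derivative of the potential,
    which is why only the derivatives of [u], [v] and [tau] remain. *)
Lemma bernoulli_derivative (g : gas) (G : flow_curve) (theta : R -> R) (s : R) :
  gas_ok g -> carries_flow g G theta -> 0 <= s < len G ->
  cU G s * Derive (cu G) s + cV G s * Derive (cv G) s
  + ctau G s * Derive (pressure g) (ctau G s) * Derive (ctau G) s = 0.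
Proof.
  intros (_ & _ & Hb & Hg) HG Hs.
  destruct (cf_adm _ _ _ HG s ltac:(lra)) as [Hbt _].
  pose proof (is_derive_enthalpy g (ctau G s) ltac:(lra) (proj1 Hg)) as Hh.
  pose proof (ex_derive_smooth_data _ _ _ (cf_u _ _ _ HG) Hs).
  pose proof (ex_derive_smooth_data _ _ _ (cf_v _ _ _ HG) Hs).
  pose proof (ex_derive_smooth_data _ _ _ (cf_tau _ _ _ HG) Hs).
  pose proof (cf_tangent_xi _ _ _ HG s Hs) as Hxi.
  pose proof (cf_tangent_eta _ _ _ HG s Hs) as Heta.
  pose proof (cf_potential _ _ _ HG s Hs) as Hphi.
  apply (derive_zero_of_right
    (fun t => (cU G t ^ 2 + cV G t ^ 2) / 2 + enthalpy g (ctau G t) + cphi G t)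
    s _ (len G)); [lra| |].
  - intros t Ht. apply (cf_bernoulli _ _ _ HG); lra.
  - unfold cU, cV in *.
    auto_derive.
    + repeat split; auto; eexists; eassumption.
    + eta_derive.
      rewrite (is_derive_unique (cxi G) _ _ Hxi),
        (is_derive_unique (ceta G) _ _ Heta),
        (is_derive_unique (cphi G) _ _ Hphi),
        (is_derive_unique (enthalpy g) _ _ Hh).
      field.
Qed.

(** The derivative of [U sin alpha - V cos alpha = - c]: the tangential component
    multiplies [alpha'], and the motion of the point in the direction
    [- (cos beta, sin beta)] contributes [sin (alpha - beta)]. *)
Lemma alpha_derivative (g : gas) (G : flow_curve) (s : R) :
  0 < gb g -> carries_flow g G (fun t => cbeta G t + PI) ->
  backward_flow g G -> 0 <= s < len G ->
  Derive (calpha G) s * sonic_distance g G s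
  = Derive (csound g G) s
    + (Derive (cu G) s * sin (calpha G s) - Derive (cv G) s * cos (calpha G s))
    + sin (2 * comega G s).
Proof.
  intros Hb HG Hbk Hs.
  pose proof (ex_derive_smooth_data _ _ _ (cf_u _ _ _ HG) Hs).
  pose proof (ex_derive_smooth_data _ _ _ (cf_v _ _ _ HG) Hs).
  pose proof (ex_derive_smooth_data _ _ _ (cf_alpha _ _ _ HG) Hs).
  pose proof (ex_derive_csound _ _ _ _ Hb HG Hs).
  pose proof (cf_tangent_xi _ _ _ HG s Hs) as Hxi.
  pose proof (cf_tangent_eta _ _ _ HG s Hs) as Heta.
  destruct (backward_flow_components g G s Hbk Hs) as [_ HM].
  apply Rminus_diag_uniq_sym.
  apply (derive_zero_of_right
    (fun t => cU G t * sin (calpha G t) - cV G t * cos (calpha G t) + csound g G t)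
    s _ (len G)); [lra| |].
  - intros t Ht. destruct (backward_flow_components g G t Hbk ltac:(lra)). lra.
  - replace (Derive (calpha G) s * sonic_distance g G s)
      with (- (Derive (calpha G) s * - sonic_distance g G s)) by ring.
    rewrite <- HM.
    replace (2 * comega G s) with (calpha G s - cbeta G s) by (unfold comega; field).
    rewrite sin_minus.
    unfold cU, cV in *.
    auto_derive.
    + repeat split; auto; eexists; eassumption.
    + eta_derive.
      rewrite (is_derive_unique (cxi G) _ _ Hxi),
        (is_derive_unique (ceta G) _ _ Heta).
      rewrite neg_sin, neg_cos.
      ring.
Qed.

(** The characteristic relation makes [(u', v') = k (sin alpha, - cos alpha)],
    [k] being the quantity of the conclusion; since the flow has component [- c]
    in that direction, Bernoulli's law becomes [k c = tau p' tau'], and both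
    [p'] and [tau'] are negative. *)
Lemma velocity_derivative_pos (g : gas) (G : flow_curve) (theta : R -> R) (s : R) :
  gas_ok g -> carries_flow g G theta -> backward_flow g G -> 0 <= s < len G ->
  cos (calpha G s) * Derive (cu G) s + sin (calpha G s) * Derive (cv G) s = 0 ->
  0 < Derive (csound g G) s ->
  0 < Derive (cu G) s * sin (calpha G s) - Derive (cv G) s * cos (calpha G s).
Proof.
  intros Hg HG Hbk Hs Hrel Hdc.
  pose proof (bernoulli_derivative g G theta s Hg HG Hs) as HB.
  destruct Hg as (_ & _ & Hb & _).
  pose proof (csound_pos g G theta s Hb HG ltac:(lra)) as Hc.
  destruct (backward_flow_components g G s Hbk Hs) as [HN _].
  pose proof (cf_adm _ _ _ HG s ltac:(lra)) as Ha.
  pose proof (kappa_denominator_pos g _ Ha) as Hk.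
  assert (Hdtau : Derive (ctau G) s < 0).
  { unfold csound in Hdc, Hc.
    rewrite (Derive_comp (sound g) (ctau G)) in Hdc.
    - rewrite (is_derive_unique _ _ _ (is_derive_sound g _ Hb Ha)) in Hdc.
      destruct Ha as (Hbt & _).
      assert (Hcoef : 0 < ctau G s * (2 * Derive (pressure g) (ctau G s) +
         ctau G s * Derive_n (pressure g) 2 (ctau G s)) / (2 * sound g (ctau G s))).
      { apply Rdiv_lt_0_compat; [apply Rmult_lt_0_compat|]; lra. }
      unfold Rdiv in *. nra.
    - eexists. apply is_derive_sound; assumption.
    - apply (ex_derive_smooth_data _ _ _ (cf_tau _ _ _ HG) Hs). }
  destruct Ha as (Hbt & Hp & _).
  set (du := Derive (cu G) s) in *. set (dv := Derive (cv G) s) in *.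
  set (ca := cos (calpha G s)) in *. set (sa := sin (calpha G s)) in *.
  assert (Hsc : sa * sa + ca * ca = 1).
  { pose proof (sin2_cos2 (calpha G s)) as H. unfold Rsqr in H. exact H. }
  set (k := du * sa - dv * ca).
  assert (Hdu : du = k * sa).
  { transitivity (du * (sa * sa + ca * ca) - ca * (ca * du + sa * dv));
      [rewrite Hsc, Hrel|unfold k]; ring. }
  assert (Hdv : dv = - k * ca).
  { transitivity (dv * (sa * sa + ca * ca) - sa * (ca * du + sa * dv));
      [rewrite Hsc, Hrel|unfold k]; ring. }
  assert (Hkc : k * csound g G s
    = ctau G s * Derive (pressure g) (ctau G s) * Derive (ctau G) s).
  { transitivity (- (k * (cU G s * sa - cV G s * ca)));
      [rewrite HN; ring|]. rewrite Hdu, Hdv in HB. lra. }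
  assert (0 < ctau G s * (- Derive (pressure g) (ctau G s)))
    by (apply Rmult_lt_0_compat; lra).
  nra.
Qed.

(** * Envelope of the rays and blow-up *)

(** The derivative of [line_eq] in the parameter at distance [r] is
    [r alpha' - sin (alpha - beta)]: turning of the line against displacement of
    its base point. *)
Lemma ray_envelope_iff (G : flow_curve) (s r : R) :
  ex_derive (calpha G) s ->
  is_derive (cxi G) s (cos (cbeta G s + PI)) ->
  is_derive (ceta G) s (sin (cbeta G s + PI)) ->
  ray_envelope G s r <-> r * Derive (calpha G) s = sin (2 * comega G s).
Proof.
  intros Ha Hxi Heta.
  assert (HD : is_derive (fun t => line_eq G t (ray_xi G s r) (ray_eta G s r)) s
     (r * Derive (calpha G) s - sin (2 * comega G s))).
  { replace (2 * comega G s) with (calpha G s - cbeta G s) by (unfold comega; field).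
    pose proof (sin2_cos2 (calpha G s)) as Hsc. unfold Rsqr in Hsc.
    replace (r * Derive (calpha G) s) with (r * Derive (calpha G) s *
      (sin (calpha G s) * sin (calpha G s) + cos (calpha G s) * cos (calpha G s)))
      by (rewrite Hsc; ring).
    unfold line_eq, ray_xi, ray_eta. auto_derive.
    - repeat split; auto; eexists; eassumption.
    - eta_derive.
      rewrite (is_derive_unique (cxi G) _ _ Hxi),
        (is_derive_unique (ceta G) _ _ Heta).
      rewrite neg_sin, neg_cos, sin_minus.
      ring. }
  split.
  - intros [_ H]. apply is_derive_unique in H, HD. lra.
  - intros H. split.
    + unfold line_eq, ray_xi, ray_eta. ring.
    + replace 0 with (r * Derive (calpha G) s - sin (2 * comega G s)) by lra.
      exact HD.
Qed.

Lemma sin_2_asin (x : R) : -1 <= x <= 1 -> sin (2 * asin x) = 2 * x * sqrt (1 - x ^ 2).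
Proof.
  intros Hx. rewrite sin_2a, sin_asin, cos_asin by lra.
  unfold Rsqr. do 2 f_equal. ring.
Qed.

(** [sin (2 asin (c / q))] with [q^2 = c^2 + (r - d)^2], [d] the sonic distance;
    before the sonic point the cosine of the Mach angle is [(d - r) / q]. *)
Lemma sin_ray_angles (g : gas) (G : flow_curve) (s r : R) :
  backward_flow g G -> 0 <= s < len G -> 0 < csound g G s ->
  r < sonic_distance g G s ->
  sin (calpha G s - ray_beta g G s r)
  = 2 * csound g G s * (sonic_distance g G s - r)
    / (csound g G s ^ 2 + (r - sonic_distance g G s) ^ 2).
Proof.
  intros Hbk Hs Hc Hr. unfold ray_beta.
  rewrite (ray_q2_sonic_distance g G s r Hbk Hs).
  set (c := csound g G s) in *. set (d := sonic_distance g G s) in *.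
  set (q2 := c ^ 2 + (r - d) ^ 2).
  assert (Hq2 : c ^ 2 < q2) by (unfold q2; nra).
  assert (Hq : 0 < sqrt q2) by (apply sqrt_lt_R0; nra).
  assert (Hqq : sqrt q2 ^ 2 = q2) by (apply pow2_sqrt; nra).
  assert (Hcq : c < sqrt q2) by nra.
  set (q := sqrt q2) in *.
  assert (Hx : 0 < c / q < 1).
  { split; [apply Rdiv_lt_0_compat; lra|].
    apply Rmult_lt_reg_r with q; [lra|]. field_simplify; lra. }
  replace (calpha G s - (calpha G s - 2 * asin (c / q))) with (2 * asin (c / q)) by ring.
  rewrite sin_2_asin by lra.
  replace (sqrt (1 - (c / q) ^ 2)) with ((d - r) / q).
  - rewrite <- Hqq. field. lra.
  - symmetry. apply sqrt_lem_1.
    + assert ((c / q) ^ 2 < 1) by nra. lra.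
    + apply Rlt_le, Rdiv_lt_0_compat; lra.
    + replace ((d - r) / q * ((d - r) / q)) with ((q2 - c ^ 2) / q ^ 2)
        by (unfold q2; field; lra).
      rewrite <- Hqq. field. lra.
Qed.

(** The Jacobian of [(s, r)] coordinates is [sin (2 omega) - r alpha'], the same
    quantity that vanishes on the envelope. *)
Lemma ray_dminus_c_eq (g : gas) (G : flow_curve) (s r : R) :
  ex_derive (calpha G) s ->
  is_derive (cxi G) s (cos (cbeta G s + PI)) ->
  is_derive (ceta G) s (sin (cbeta G s + PI)) ->
  - ray_dminus_c g G s r
  = Derive (csound g G) s * sin (calpha G s - ray_beta g G s r)
    / (sin (2 * comega G s) - r * Derive (calpha G) s).
Proof.
  intros Ha Hxi Heta. unfold ray_dminus_c.
  assert (E1 : Derive (fun t => ray_xi G t r) s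
    = - cos (cbeta G s) + r * Derive (calpha G) s * sin (calpha G s)).
  { apply is_derive_unique. unfold ray_xi. auto_derive.
    - repeat split; auto; eexists; eassumption.
    - eta_derive.
      rewrite (is_derive_unique (cxi G) _ _ Hxi), neg_cos.
      ring. }
  assert (E2 : Derive (fun t => ray_eta G t r) s
    = - sin (cbeta G s) - r * Derive (calpha G) s * cos (calpha G s)).
  { apply is_derive_unique. unfold ray_eta. auto_derive.
    - repeat split; auto; eexists; eassumption.
    - eta_derive.
      rewrite (is_derive_unique (ceta G) _ _ Heta), neg_sin.
      ring. }
  assert (E3 : Derive (fun t => ray_xi G s t) r = - cos (calpha G s)).
  { apply is_derive_unique. unfold ray_xi. auto_derive; [exact I|ring]. }
  assert (E4 : Derive (fun t => ray_eta G s t) r = - sin (calpha G s)).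
  { apply is_derive_unique. unfold ray_eta. auto_derive; [exact I|ring]. }
  rewrite E1, E2, E3, E4.
  pose proof (sin2_cos2 (calpha G s)) as Hsc. unfold Rsqr in Hsc.
  replace (2 * comega G s) with (calpha G s - cbeta G s) by (unfold comega; field).
  replace (r * Derive (calpha G) s) with (r * Derive (calpha G) s *
      (sin (calpha G s) * sin (calpha G s) + cos (calpha G s) * cos (calpha G s))) at 3
      by (rewrite Hsc; ring).
  rewrite !sin_minus. unfold Rdiv.
  match goal with |- - (_ * (_ * / ?x)) = _ * / ?y => replace x with y by ring end.
  ring.
Qed.

(** At [B] the gas is at rest and [beta = 0]. The pseudo-velocity is minus the
    position there, and the position lies in the first quadrant, as does the
    direction of angle [sigma = alpha / 2]. *)
Lemma patch_backward_flow (g : gas) (rho1 rho4 v1 : R) (AB BC : flow_curve)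
  (betaC xiD etaD : R) :
  0 < gb g -> patch_data g rho1 rho4 v1 AB BC betaC xiD etaD -> backward_flow g BC.
Proof.
  intros Hb hd.
  pose proof PI_RGT_0 as Hpi.
  pose proof (cf_len _ _ _ (pd_AB _ _ _ _ _ _ _ _ _ hd)) as HlA.
  pose proof (cf_len _ _ _ (pd_BC _ _ _ _ _ _ _ _ _ hd)) as HlB.
  apply (backward_flow_of_start g BC _ Hb (pd_BC _ _ _ _ _ _ _ _ _ hd)).
  - intros s Hs. pose proof (pd_BC_omega _ _ _ _ _ _ _ _ _ hd s Hs). lra.
  - destruct (pd_BC_compat _ _ _ _ _ _ _ _ _ hd) as (Hu & Hv & _ & _ & Ha & Hbt).
    destruct (pd_BC_start _ _ _ _ _ _ _ _ _ hd) as [Hxi Heta].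
    destruct (pd_AB_angles _ _ _ _ _ _ _ _ _ hd 0 ltac:(lra)) as [Hb0 Ha0].
    pose proof (pd_AB_right _ _ _ _ _ _ _ _ _ hd 0 ltac:(lra)) as Hx0.
    pose proof (pd_B _ _ _ _ _ _ _ _ _ hd) as He0.
    pose proof (pd_c _ _ _ _ _ _ _ _ _ hd) as Hc.
    unfold flow_along, cU, cV. rewrite Hu, Hv, Hxi, Heta, Ha, Hbt, Hb0, He0.
    set (sg := (calpha AB 0 + 0) / 2).
    assert (0 < sin sg) by (apply sin_gt_0; unfold sg; lra).
    assert (0 <= cos sg) by (apply cos_ge_0; unfold sg; lra).
    nra.
Qed.

Theorem theorem6p1 (g : gas) (rho1 rho4 v1 : R) (AB BC : flow_curve)
  (betaC xiD etaD : R)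
  (hg : gas_ok g)
  (hdata : patch_data g rho1 rho4 v1 AB BC betaC xiD etaD)
  (s : R) (hs : 0 <= s < len BC) :
  exists r_env r_sonic : R,
    first_distance (ray_envelope BC s) r_env
    /\ first_distance (ray_sonic g BC s) r_sonic
    /\ 0 < r_env < r_sonic
    /\ filterlim (fun r => - ray_dminus_c g BC s r)
         (at_left r_env) (Rbar_locally p_infty).
Proof.
  assert (Hb : 0 < gb g) by apply hg.
  pose proof (patch_backward_flow _ _ _ _ _ _ _ _ _ Hb hdata) as Hbk.
  pose proof (pd_BC _ _ _ _ _ _ _ _ _ hdata) as HG.
  pose proof (pd_BC_omega _ _ _ _ _ _ _ _ _ hdata s hs) as Hw.
  pose proof (pd_BC_dc _ _ _ _ _ _ _ _ _ hdata s hs) as Hdc.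
  pose proof (csound_pos g BC _ s Hb HG ltac:(lra)) as Hc.
  pose proof (alpha_derivative g BC s Hb HG Hbk hs) as Hda.
  pose proof (velocity_derivative_pos g BC _ s hg HG Hbk hs
    (pd_BC_relation _ _ _ _ _ _ _ _ _ hdata s hs) Hdc) as Hk.
  pose proof (ex_derive_smooth_data _ _ _ (cf_alpha _ _ _ HG) hs) as Hxa.
  pose proof (cf_tangent_xi _ _ _ HG s hs) as Hxi. cbv beta in Hxi.
  pose proof (cf_tangent_eta _ _ _ HG s hs) as Heta. cbv beta in Heta.
  pose proof (fun r => ray_envelope_iff BC s r Hxa Hxi Heta) as Henv.
  pose proof (fun r => ray_q2_sonic_distance g BC s r Hbk hs) as Hq2.
  assert (Hs2 : 0 < sin (2 * comega BC s)) by (apply sin_gt_0; lra).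
  assert (Hd : 0 < sonic_distance g BC s).
  { unfold sonic_distance.
    assert (0 < sin (comega BC s)) by (apply sin_gt_0; lra).
    assert (0 < cos (comega BC s)) by (apply cos_gt_0; lra).
    apply Rdiv_lt_0_compat; [apply Rmult_lt_0_compat|]; lra. }
  set (d := sonic_distance g BC s) in *.
  set (s2 := sin (2 * comega BC s)) in *.
  set (a' := Derive (calpha BC) s) in *.
  assert (HSa : s2 < a' * d) by lra.
  assert (Ha' : 0 < a') by nra.
  assert (Hr : (s2 / a') * a' = s2) by (field; lra).
  exists (s2 / a'), d.
  assert (Hlt : 0 < s2 / a' < d).
  { split; [apply Rdiv_lt_0_compat; lra|].
    apply Rmult_lt_reg_r with a'; lra. }
  set (re := s2 / a') in *.
  split; [|split; [|split; [exact Hlt|]]].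
  - split; [lra|split].
    + apply Henv. exact Hr.
    + intros r Hr' He. apply Henv in He. nra.
  - split; [lra|split].
    + unfold ray_sonic. rewrite Hq2. fold d. ring.
    + intros r Hr' He. unfold ray_sonic in He. rewrite Hq2 in He. fold d in He. nra.
  - set (c := csound g BC s) in *. set (c' := Derive (csound g BC) s) in *.
    apply (filterlim_ext_loc (fun r =>
      c' * (2 * c * (d - r) / (c ^ 2 + (r - d) ^ 2)) / (a' * (re - r)))).
    + unfold at_left, within. apply filter_forall. intros r Hr'.
      rewrite (ray_dminus_c_eq g BC s r Hxa Hxi Heta).
      rewrite (sin_ray_angles g BC s r Hbk hs Hc) by (fold d; lra).
      fold c c' d s2 a'. rewrite <- Hr.
      f_equal. ring.
    + assert (Hc2 : 0 < c ^ 2 + (re - d) ^ 2) by nra.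
      apply filterlim_div_at_left; [lra| |].
      * refine (ex_derive_continuous _ _ _). auto_derive. nra.
      * apply Rmult_lt_0_compat; [lra|]. apply Rdiv_lt_0_compat; nra.
Qed.
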